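(* Let $\Pi=[\pi_1,\dots,\pi_m]$ be a list of rankings of an $n$-element set $U$, and suppose the rank trees of $\Pi$ are available. Then for any given ranking $\pi$ of $U$, the footrule distance $\mathcal{F}(\pi,\Pi)=\sum_{i=1}^m\sum_{e\in U}|\pi(e)-\pi_i(e)|$ can be computed in $O(n\log n)$ time.
   Context: A ranking of $U$, $|U|=n$, is a bijection $\pi:U\to\{1,\dots,n\}$. For each $e\in U$, the rank tree $\mathcal{R}(e)$ is a balanced binary search tree on the keys $1,2,\dots,n$; each node $u$ with key $v$ stores $re(u)=\#\{i:\pi_i(e)=v\}$, $size(u)=\sum_w re(w)$ and $sum(u)=\sum_w re(w)\cdot\mathrm{key}(w)$, the sums ranging over the nodes $w$ of the subtree rooted at $u$; an array gives constant-time access to the root of each $\mathcal{R}(e)$. Counters and sums are assumed to occupy $O(1)$ space with $O(1)$-time arithmetic. *)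

(* Defs.v *)
From HB Require Import structures.
From mathcomp Require Import all_boot all_order all_algebra.
Set Implicit Arguments.
Unset Strict Implicit.
Unset Printing Implicit Defensive.
Import GRing.Theory Num.Theory.
Local Open Scope ring_scope.

Record ranking (U : finType) := Ranking {
  rank :> U -> nat;
  rank_range : forall e, (1 <= rank e <= #|U|)%N;
  rank_inj : injective rank;
  rank_surj : forall v, (1 <= v <= #|U|)%N -> exists e, rank e = v }.

Definition footrule (U : finType) (pi : ranking U) (Pi : seq (ranking U)) : int :=
  \sum_(p <- Pi) \sum_(e : U) `|(pi e)%:Z - (p e)%:Z|.

Record node := Node { key : nat; re : nat; nsize : nat; nsum : nat }.

Inductive tree := Leaf | Bin (l : tree) (x : node) (r : tree).

Fixpoint nodes (t : tree) : seq node :=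
  if t is Bin l x r then nodes l ++ x :: nodes r else [::].

(* Number of levels; Leaf is the empty tree. *)
Fixpoint height (t : tree) : nat :=
  if t is Bin l _ r then (maxn (height l) (height r)).+1 else 0%N.

Fixpoint is_bst (t : tree) : bool :=
  if t is Bin l x r then
    [&& all (fun w => key w < key x)%N (nodes l),
        all (fun w => key x < key w)%N (nodes r), is_bst l & is_bst r]
  else true.

Fixpoint annotated (U : finType) (Pi : seq (ranking U)) (e : U) (t : tree) : Prop :=
  if t is Bin l x r then
    [/\ re x = count (fun p : ranking U => p e == key x) Pi,
        nsize x = (\sum_(w <- nodes t) re w)%N,
        nsum x = (\sum_(w <- nodes t) re w * key w)%N,
        annotated Pi e l & annotated Pi e r]
  else True.

(* "Balanced" is height O(log n): at most c times the least possible number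
   of levels, ceil(log2 (n + 1)), of a binary tree with n nodes. *)
Definition balanced (c n : nat) (t : tree) : Prop :=
  (height t <= c * up_log 2 n.+1)%N.

Definition rank_tree (c : nat) (U : finType) (Pi : seq (ranking U)) (e : U)
    (t : tree) : Prop :=
  [/\ is_bst t, perm_eq (map key (nodes t)) (iota 1 #|U|),
      balanced c #|U| t & annotated Pi e t].

(* Unit-cost random access machine over the integers: integer registers, an
   integer-addressed memory with indirect access, and +, -, *, comparisons in
   one step each.  Jump targets are absolute positions in the program. *)
Inductive instr :=
| IConst (d : nat) (k : int)
| IMove (d a : nat)
| IAdd (d a b : nat)
| ISub (d a b : nat)
| IMul (d a b : nat)
| IRead (d a : nat)
| IWrite (a s : nat)
| IJump (l : nat)
| IJumpLt (a b l : nat)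
| IJumpEq (a b l : nat)
| IHalt.

Definition program := seq instr.
Definition memory := int -> int.

Record state := State { pc : nat; reg : nat -> int; ram : memory }.

Definition upd (T : eqType) (f : T -> int) (x : T) (v : int) : T -> int :=
  fun y => if y == x then v else f y.

Definition fetch (P : program) (s : state) : instr := nth IHalt P (pc s).

Definition set_reg (s : state) (d : nat) (v : int) : state :=
  State (pc s).+1 (upd (reg s) d v) (ram s).

Definition goto (s : state) (l : nat) : state := State l (reg s) (ram s).

Definition step (P : program) (s : state) : state :=
  match fetch P s with
  | IConst d k => set_reg s d k
  | IMove d a => set_reg s d (reg s a)
  | IAdd d a b => set_reg s d (reg s a + reg s b)
  | ISub d a b => set_reg s d (reg s a - reg s b)
  | IMul d a b => set_reg s d (reg s a * reg s b)
  | IRead d a => set_reg s d (ram s (reg s a))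
  | IWrite a v => State (pc s).+1 (reg s) (upd (ram s) (reg s a) (reg s v))
  | IJump l => goto s l
  | IJumpLt a b l => goto s (if reg s a < reg s b then l else (pc s).+1)
  | IJumpEq a b l => goto s (if reg s a == reg s b then l else (pc s).+1)
  | IHalt => s
  end.

Definition halted (P : program) (s : state) : Prop := fetch P s = IHalt.

Definition init (args : seq int) (M : memory) : state :=
  State 0 (fun i => nth 0 args i) M.

(* Started on args (registers 0, 1, ...; the others are 0) and memory M, the
   program halts after at most t steps with v in register 0. *)
Definition computes_within (P : program) (args : seq int) (M : memory)
    (t : nat) (v : int) : Prop :=
  let s := iter t (step P) (init args M) in halted P s /\ reg s 0%N = v.

(* The empty tree is the null pointer 0; a node at address a <> 0 occupies the
   cells a, ..., a + 5: key, re, size, sum, left child, right child. *)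
Fixpoint stored_tree (M : memory) (a : int) (t : tree) : Prop :=
  if t is Bin l x r then
    [/\ a <> 0,
        [/\ M a = (key x)%:Z, M (a + 1) = (re x)%:Z,
            M (a + 2) = (nsize x)%:Z & M (a + 3) = (nsum x)%:Z],
        stored_tree M (M (a + 4)) l & stored_tree M (M (a + 5)) r]
  else a = 0.

(* Arrays indexed by U, whose elements are numbered 0, ..., #|U| - 1 by
   enum_rank; b is the base address. *)
Definition cell (U : finType) (M : memory) (b : int) (e : U) : int :=
  M (b + (nat_of_ord (enum_rank e))%:Z).

Definition stored_roots (U : finType) (M : memory) (b : int) (R : U -> tree) : Prop :=
  forall e, stored_tree M (cell M b e) (R e).

Definition stored_ranking (U : finType) (M : memory) (b : int) (pi : ranking U) : Prop :=
  forall e, cell M b e = (pi e)%:Z.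

(* Main.v *)
(* For a fixed element e put v = pi(e), and for a subtree t of R(e) let G(t) be
   the sum of re(w) (key(w) - v) over the nodes w of t, which is sum - v * size
   at its root.  The search for v in R(e) discards, at every node, a part of the
   tree on which all the terms key(w) - v have the same sign; its contribution
   to the sum of re(w) |v - key(w)| is therefore, up to sign, the difference of
   the values of G at the node and at the child where the search goes on.  Hence
   one root-to-leaf walk, of length O(log n), per element of U suffices. *)
Require Import Defs.
From mathcomp Require Import all_boot all_order all_algebra.
From mathcomp Require Import ring zify.
Set Implicit Arguments.
Unset Strict Implicit.
Unset Printing Implicit Defensive.
Import Order.TTheory GRing.Theory Num.Theory.
Local Open Scope ring_scope.

(** * The signed sum G ([deviation]) and the absolute sum wanted for each element *)

Definition deviation (v : int) (t : tree) : int :=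
  \sum_(w <- nodes t) (re w)%:Z * ((key w)%:Z - v).

Definition abs_deviation (v : int) (t : tree) : int :=
  \sum_(w <- nodes t) (re w)%:Z * `|v - (key w)%:Z|.

Lemma deviation_node (v : int) l x r :
  deviation v (Bin l x r) =
  deviation v l + (re x)%:Z * ((key x)%:Z - v) + deviation v r.
Proof. by rewrite /deviation /= big_cat big_cons /= addrA. Qed.

Lemma abs_deviation_node (v : int) l x r :
  abs_deviation v (Bin l x r) =
  abs_deviation v l + (re x)%:Z * `|v - (key x)%:Z| + abs_deviation v r.
Proof. by rewrite /abs_deviation /= big_cat big_cons /= addrA. Qed.

Lemma abs_deviation_ge (v : int) t :
  all (fun w => v <= (key w)%:Z) (nodes t) -> abs_deviation v t = deviation v t.
Proof.
rewrite /abs_deviation /deviation; elim: (nodes t) => [|w s IHs] /=.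
  by rewrite !big_nil.
move=> /andP[lew /IHs eqs]; rewrite !big_cons eqs.
by rewrite distrC ger0_norm // subr_ge0.
Qed.

Lemma abs_deviation_le (v : int) t :
  all (fun w => (key w)%:Z <= v) (nodes t) ->
  abs_deviation v t = - deviation v t.
Proof.
rewrite /abs_deviation /deviation; elim: (nodes t) => [|w s IHs] /=.
  by rewrite !big_nil oppr0.
move=> /andP[lew /IHs eqs]; rewrite !big_cons eqs ger0_norm ?subr_ge0 //.
by rewrite opprD -mulrN opprB.
Qed.

Lemma deviation_root (U : finType) (Pi : seq (ranking U)) e (v : int) l x r :
  annotated Pi e (Bin l x r) ->
  (nsum x)%:Z - (nsize x)%:Z * v = deviation v (Bin l x r).
Proof.
case=> _ -> -> _ _; rewrite /deviation; elim: (nodes _) => [|w s IHs].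
  by rewrite !big_nil mul0r subr0.
rewrite !big_cons -IHs !PoszD PoszM; ring.
Qed.

Lemma abs_deviation_annotated (U : finType) (Pi : seq (ranking U)) e t :
  annotated Pi e t ->
  abs_deviation^~ t =1 fun v =>
    \sum_(w <- nodes t)
       (count (fun p : ranking U => p e == key w) Pi)%:Z * `|v - (key w)%:Z|.
Proof.
move=> ann v; elim: t ann => [|l IHl x r IHr] /=.
  by rewrite /abs_deviation !big_nil.
case=> re_x _ _ /IHl eql /IHr eqr.
by rewrite abs_deviation_node big_cat big_cons /= eql eqr re_x addrA.
Qed.

(** The counts [re] group the rankings by their value at [e]. By induction on [Pi], each [p]
    contributes at exactly one key, as [p e] lies in the range of keys and keys are distinct. *)
Lemma abs_deviation_rank_tree c (U : finType) (Pi : seq (ranking U)) e t v :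
  rank_tree c Pi e t ->
  abs_deviation v t = \sum_(p <- Pi) `|v - (p e)%:Z|.
Proof.
case=> _ keys _ /abs_deviation_annotated ->.
pose F k : int := (count (fun p : ranking U => p e == k) Pi)%:Z * `|v - k%:Z|.
rewrite -(big_map key predT F) (perm_big _ keys) /= {keys}/F.
elim: Pi => [|p Pi IHPi].
  by rewrite big_nil big1 // => k _; rewrite mul0r.
rewrite big_cons -IHPi /=.
under eq_bigr do rewrite PoszD mulrDl.
rewrite big_split /=; congr (_ + _).
have pe_iota : p e \in iota 1 #|U| by rewrite mem_iota add1n ltnS rank_range.
rewrite (bigD1_seq (p e)) ?iota_uniq //= eqxx mul1r big1 ?addr0 // => k.
by rewrite eq_sym => /negPf->; rewrite mul0r.
Qed.

(** * The machine program and its walk down one rank tree *)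

Lemma iterDr (T : Type) m n (f : T -> T) x :
  iter (m + n) f x = iter n f (iter m f x).
Proof. by rewrite addnC iterD. Qed.

(* Registers: 1, 2 - addresses of the current entries of the arrays of roots and
   of ranks; 3 - accumulated distance; 4 - the constant 1; 5 - end of the array
   of roots; 6 - the constant 0; 7 - current node; 8 - rank v of the current
   element; 9 - sign of the last move (1 left, -1 right, 0 at the root);
   10 - key of the current node; 12 - its deviation G.
   The outer loop starts at 2, the tree walk at 6.  The value of G at a node is
   subtracted on arrival there rather than on departure from its parent, since
   the child may be the null pointer. *)
Definition footrule_program : program := [::
  IConst 4 1;
  IAdd 5 1 0;
  IJumpEq 1 5 30;
  IRead 7 1;
  IRead 8 2;
  IConst 9 0;
  IJumpEq 7 6 27;
  IRead 10 7;
  IAdd 7 7 4;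
  IAdd 7 7 4;
  IRead 11 7;
  IAdd 7 7 4;
  IRead 12 7;
  IMul 11 11 8;
  ISub 12 12 11;
  IMul 11 9 12;
  ISub 3 3 11;
  IAdd 7 7 4;
  IJumpLt 8 10 23;
  IAdd 7 7 4;
  ISub 3 3 12;
  IConst 9 (-1);
  IJump 25;
  IAdd 3 3 12;
  IMove 9 4;
  IRead 7 7;
  IJump 6;
  IAdd 1 1 4;
  IAdd 2 2 4;
  IJump 2;
  IMove 0 3;
  IHalt].

Local Notation run n s := (iter n (step footrule_program) s).

Record loop_state (M : memory) (pcv : nat) (i j acc stop : int) (s : state)
    : Prop := LoopState {
  loop_pc : pc s = pcv;
  loop_ram : ram s = M;
  loop_roots : reg s 1%N = i;
  loop_ranks : reg s 2 = j;
  loop_acc : reg s 3 = acc;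
  loop_one : reg s 4 = 1;
  loop_stop : reg s 5 = stop;
  loop_zero : reg s 6 = 0 }.

Record walk_state (a v sg : int) (s : state) : Prop := WalkState {
  walk_node : reg s 7 = a;
  walk_rank : reg s 8 = v;
  walk_sign : reg s 9 = sg }.

Local Arguments iter : simpl never.

Lemma walk_left (M : memory) (a v sg i j acc stop : int) s :
  loop_state M 6 i j acc stop s -> walk_state a v sg s ->
  a <> 0 -> v < M a ->
  let g := M (a + 3) - M (a + 2) * v in
  loop_state M 6 i j (acc - sg * g + g) stop (run 17 s) /\
  walk_state (M (a + 4)) v 1 (run 17 s).
Proof.
case: s => p r m [/= -> -> r1 r2 r3 r4 r5 r6] [/= r7 r8 r9] a0 lt_va.
have -> : a + 4 = a + 1 + 1 + 1 + 1 by ring.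
have -> : a + 3 = a + 1 + 1 + 1 by ring.
have -> : a + 2 = a + 1 + 1 by ring.
case def_s': (run 17 _) => [p' r' m']; move: def_s'.
(* The second occurrence of [step] is the one applied to the current state, so each such rewrite
   executes a single instruction. *)
rewrite iterSr {2}/step /= /goto /= r7 r6 (introF eqP a0).
do 11 rewrite iterSr {2}/step /= /set_reg /upd /=.
rewrite iterSr {2}/step /= /goto /= r7 r8 lt_va.
do 4 rewrite iterSr {2}/step /= /set_reg /upd /=.
by case=> <- <- <-; split; split; rewrite //= ?r3 ?r4 ?r7 ?r8 ?r9.
Qed.

Lemma walk_right (M : memory) (a v sg i j acc stop : int) s :
  loop_state M 6 i j acc stop s -> walk_state a v sg s ->
  a <> 0 -> M a <= v ->
  let g := M (a + 3) - M (a + 2) * v in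
  loop_state M 6 i j (acc - sg * g - g) stop (run 19 s) /\
  walk_state (M (a + 5)) v (-1) (run 19 s).
Proof.
case: s => p r m [/= -> -> r1 r2 r3 r4 r5 r6] [/= r7 r8 r9] a0 le_av.
have -> : a + 5 = a + 1 + 1 + 1 + 1 + 1 by ring.
have -> : a + 3 = a + 1 + 1 + 1 by ring.
have -> : a + 2 = a + 1 + 1 by ring.
case def_s': (run 19 _) => [p' r' m']; move: def_s'.
rewrite iterSr {2}/step /= /goto /= r7 r6 (introF eqP a0).
do 11 rewrite iterSr {2}/step /= /set_reg /upd /=.
rewrite iterSr {2}/step /= /goto /= r7 r8 ltNge le_av /=.
do 6 rewrite iterSr {2}/step /= /set_reg /upd /=.
by case=> <- <- <-; split; split; rewrite //= ?r3 ?r4 ?r7 ?r8 ?r9.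
Qed.

(** The term [- sg * deviation v t] is the half of the difference of G that the parent left pending;
    at a null pointer it vanishes. A level costs 17 steps to the left and 19 to the right, and the
    final null test costs 1. *)
Lemma walk_correct (U : finType) (Pi : seq (ranking U)) e (M : memory)
    (i j stop : int) v t a sg acc s :
  is_bst t -> annotated Pi e t -> stored_tree M a t ->
  loop_state M 6 i j acc stop s -> walk_state a v sg s ->
  exists2 k, (k <= 19 * height t + 1)%N &
    loop_state M 27 i j (acc - sg * deviation v t + abs_deviation v t) stop
      (run k s).
Proof.
elim: t a sg acc s => [|l IHl x r IHr] a sg acc s.
  move=> _ _ /= ->; case: s => p r m [/= -> -> r1 r2 r3 r4 r5 r6] [/= r7 _ _].
  exists 1%N => //; rewrite iterSr /deviation /abs_deviation !big_nil.
  by rewrite {2}/step /= /goto /= r7 r6 /= mulr0 subr0 addr0; split.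
move=> bst ann /= [a0 [Ma _ Ma2 Ma3] stl str] loop walk.
have /= := deviation_root v ann; rewrite -Ma2 -Ma3 => gE.
case/and4P: bst => ltl gtr bstl bstr; case: ann => _ _ _ annl annr.
(* The search does not stop at a key equal to [v]: its term is 0, so it can be discarded with the
   left subtree. *)
case: (ltP v (M a)) => [lt_va | le_av].
  have /= [] := walk_left loop walk a0 lt_va; rewrite gE => loop' walk'.
  have [k le_k] := IHl _ _ _ _ bstl annl stl loop' walk'.
  rewrite -iterDr => loopk; exists (17 + k)%N; first by rewrite /=; lia.
  congr (loop_state _ _ _ _ _ _ _): loopk.
  rewrite abs_deviation_node deviation_node (@abs_deviation_ge v r).
    rewrite distrC ger0_norm; last by lia.
    by ring.
  by apply: sub_all gtr => w /=; lia.
have /= [] := walk_right loop walk a0 le_av; rewrite gE => loop' walk'.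
have [k le_k] := IHr _ _ _ _ bstr annr str loop' walk'.
rewrite -iterDr => loopk; exists (19 + k)%N; first by rewrite /=; lia.
congr (loop_state _ _ _ _ _ _ _): loopk.
rewrite abs_deviation_node deviation_node (@abs_deviation_le v l).
  rewrite ger0_norm; last by lia.
  by ring.
by apply: sub_all ltl => w /=; lia.
Qed.

(** * The loop over the elements of U *)

Lemma loop_enter (M : memory) (i j acc stop : int) s :
  loop_state M 2 i j acc stop s -> i <> stop ->
  loop_state M 6 i j acc stop (run 4 s) /\
  walk_state (M i) (M j) 0 (run 4 s).
Proof.
case: s => p r m [/= -> -> r1 r2 r3 r4 r5 r6] neq_i.
case def_s': (run 4 _) => [p' r' m']; move: def_s'.
rewrite iterSr {2}/step /= /goto /= r1 r5 (introF eqP neq_i).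
do 3 rewrite iterSr {2}/step /= /set_reg /upd /=.
by case=> <- <- <-; split; split; rewrite //= ?r1 ?r2.
Qed.

Lemma loop_next (M : memory) (i j acc stop : int) s :
  loop_state M 27 i j acc stop s ->
  loop_state M 2 (i + 1) (j + 1) acc stop (run 3 s).
Proof.
case: s => p r m [/= -> -> r1 r2 r3 r4 r5 r6].
do 3 rewrite iterSr {2}/step /= /set_reg /upd /=.
by split; rewrite //= ?r1 ?r2 ?r4.
Qed.

Lemma loop_exit (M : memory) (i j acc : int) s :
  loop_state M 2 i j acc i s ->
  halted footrule_program (run 2 s) /\ reg (run 2 s) 0%N = acc.
Proof.
case: s => p r m [/= -> -> r1 r2 r3 r4 r5 r6].
case def_s': (run 2 _) => [p' r' m']; move: def_s'.
rewrite iterSr {2}/step /= /goto /= r1 r5 eqxx.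
rewrite iterSr {2}/step /= /set_reg /upd /=.
by case=> <- <- <-; split.
Qed.

(** Two steps of initialisation; then each element costs 4 steps to enter, at most [19 * h + 1] for
    the walk and 3 to advance. *)
Lemma loop_correct (U : finType) (Pi : seq (ranking U)) (pi : ranking U)
    (R : U -> tree) (M : memory) (aR api : int) c h i :
  (forall e, rank_tree c Pi e (R e)) -> (forall e, height (R e) <= h)%N ->
  stored_roots M aR R -> stored_ranking M api pi -> (i <= #|U|)%N ->
  exists2 k, (k <= 2 + i * (19 * h + 8))%N &
    loop_state M 2 (aR + i%:Z) (api + i%:Z)
      (\sum_(e <- take i (enum U)) \sum_(p <- Pi) `|(pi e)%:Z - (p e)%:Z|)
      (aR + #|U|%:Z) (run k (init [:: Posz #|U|; aR; api] M)).
Proof.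
move=> trees heights roots ranks; elim: i => [_|i IHi lt_iU].
  exists 2 => //; rewrite take0 big_nil.
  do 2 rewrite iterSr {2}/step /= /set_reg /upd /=.
  by split; rewrite //= addr0.
have [k le_k loop] := IHi (ltnW lt_iU).
have neq_i : aR + i%:Z <> aR + #|U|%:Z by lia.
have [loop4 walk4] := loop_enter loop neq_i.
pose e := enum_val (Ordinal lt_iU).
have rank_e : enum_rank e = i :> nat by rewrite enum_valK.
have [bst _ _ ann] := trees e.
have := roots e; have := ranks e; rewrite /cell rank_e => Mapi stored.
have [k' le_k' loop'] := walk_correct bst ann stored loop4 walk4.
have loopS := loop_next loop'; rewrite -!iterDr !addnA in loopS.
exists (k + 4 + k' + 3)%N.
  by move: le_k le_k' (heights e); clear; rewrite (mulSn i); lia.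
congr (loop_state _ _ _ _ _ _ _): loopS; [lia|lia|].
(* The walk starts with sign 0, so nothing is pending at the root. *)
rewrite mul0r subr0 Mapi (abs_deviation_rank_tree _ (trees e)).
rewrite (take_nth e) -?cardE // -cats1 big_cat big_seq1 /=.
by rewrite -(enum_val_nth e (Ordinal lt_iU)).
Qed.

Lemma up_log2_succ n : (0 < n)%N -> up_log 2 n.+1 = (trunc_log 2 n).+1.
Proof. by move=> n_gt0; rewrite up_log_trunc_log. Qed.

Theorem theorem6 :
  exists P : program, forall c : nat, exists C : nat,
    forall (U : finType) (Pi : seq (ranking U)) (pi : ranking U)
           (R : U -> tree) (M : memory) (aR api : int),
      (forall e : U, rank_tree c Pi e (R e)) ->
      stored_roots M aR R ->
      stored_ranking M api pi ->
      exists t : nat,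
        computes_within P [:: Posz #|U|; aR; api] M t (footrule pi Pi) /\
        ((2 <= #|U|)%N -> (t <= C * (#|U| * trunc_log 2 #|U|))%N).
Proof.
(* With L the logarithm, L >= 1 gives 19c(L + 1) <= 38cL; the other 8 steps per element and the 4
   steps outside the loop body take at most 12nL. *)
exists footrule_program => c; exists (38 * c + 12)%N.
move=> U Pi pi R M aR api trees roots ranks.
pose h := (c * up_log 2 #|U|.+1)%N.
have heights e : (height (R e) <= h)%N by case: (trees e).
have [k le_k loop] := loop_correct trees heights roots ranks (leqnn _).
have := loop_exit loop; rewrite -iterDr => -[halt res].
exists (k + 2)%N; split.
  split=> //; rewrite res take_oversize -?cardE // big_enum.
  by rewrite exchange_big.
move=> U_ge2; have : (0 < trunc_log 2 #|U|)%N by rewrite trunc_log_gt0.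
rewrite /h up_log2_succ in le_k; last by lia.
move: (#|U|) (trunc_log 2 #|U|) U_ge2 le_k => n L n_ge2 le_k L_gt0.
have le1 : (n <= n * L)%N by rewrite leq_pmulr.
have le2 : (c * n <= c * (n * L))%N by rewrite leq_mul2l le1 orbT.
by nia.
Qed.
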